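(* Let $(G_i)_{i \in \mathbb{N}}$ be a family of finitely generated abelian groups and let $D$ be a Dedekind domain with the following properties: (i) $\operatorname{Pic}(D) \cong \bigoplus_{i \in \mathbb{N}} G_i$; (ii) for each $i \in \mathbb{N}$ there is a submonoid $S_i \subseteq D^{\bullet}$ such that $\operatorname{Pic}(D_{S_i}) \cong G_i$; (iii) each class of $\operatorname{Pic}(D)$ and of all $\operatorname{Pic}(D_{S_i})$ contains infinitely many height-one prime ideals. Let $R$ be either equal to $D$ or equal to a localization $D_S$ for a submonoid $S \subseteq D^{\bullet}$, and suppose that the Picard group $\operatorname{Pic}(R)$ is infinite. Let $\mathcal{O} \subseteq R$ be an order with conductor $\mathfrak{f}$ such that the factor group of $(R/\mathfrak{f})^{\times}/(\mathcal{O}/\mathfrak{f})^{\times}$ modulo $R^{\times}/\mathcal{O}^{\times}$ is finite. Then infinitely many classes of $\operatorname{Pic}(\mathcal{O})$ contain infinitely many invertible prime ideals.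
   Context: $\mathbb{N}$ denotes the positive integers; $D^{\bullet} = D\setminus\{0\}$ is the multiplicative monoid of nonzero elements; $D_S = S^{-1}D$. $\operatorname{Pic}$ is the group of invertible fractional ideals modulo nonzero principal fractional ideals, and its elements (classes) are regarded as sets of invertible fractional ideals. A subring $\mathcal{O}$ of a Dedekind domain $R$ is an order in $R$ if $\mathcal{O}$ and $R$ have the same quotient field and $R$ is a finitely generated $\mathcal{O}$-module. Its conductor is $\mathfrak{f} = \{a \in R \mid aR \subseteq \mathcal{O}\}$, a nonzero ideal of $R$ contained in $\mathcal{O}$. For a ring $A$, $A^{\times}$ is its unit group. The group $R^{\times}/\mathcal{O}^{\times}$ is identified with its image under the natural injective homomorphism $R^{\times}/\mathcal{O}^{\times} \to (R/\mathfrak{f})^{\times}/(\mathcal{O}/\mathfrak{f})^{\times}$ induced by reduction modulo $\mathfrak{f}$. *)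

(* Defs.v *)
From mathcomp Require Import all_boot all_order all_algebra.
From mathcomp Require Import all_classical.

Set Implicit Arguments.
Unset Strict Implicit.
Unset Printing Implicit Defensive.

Import GRing.Theory.
Local Open Scope classical_set_scope.
Local Open Scope ring_scope.

(* Integral domains are represented as subrings [A : set K] of a field [K].   *)
(* Every notion below is intrinsic to [A]: [K] may be larger than the         *)
(* quotient field of [A], which is the subset [qfield A] of [K].              *)

(* A group is given by a carrier [A : set T] and an operation [op] on [T].    *)
(* The quotient by a subgroup [B] is the set of cosets, multiplied elementwise *)
(* by [setmul op].                                                            *)
Section SetGroups.
Variables (T : Type) (op : T -> T -> T).

Definition coset (a : T) (B : set T) : set T := [set op a b | b in B].

Definition cosets (A B : set T) : set (set T) := [set coset a B | a in A].

Definition setmul (X Y : set T) : set T := [set op x y | x in X & y in Y].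

Definition unit_group (one : T) (A : set T) : set T :=
  [set u | A u /\ exists2 v, A v & op u v = one].

End SetGroups.

Definition isomorphic (T U : Type) (A : set T) (opT : T -> T -> T)
    (B : set U) (opU : U -> U -> U) : Prop :=
  exists phi : T -> U, set_bij A B phi /\
    forall x y, A x -> A y -> phi (opT x y) = opU (phi x) (phi y).

Definition fg_group (G : zmodType) : Prop :=
  exists n (g : 'I_n -> G), forall x,
    exists c : 'I_n -> int, x = \sum_(i < n) g i *~ c i.

(* The index [i : nat] stands for the positive integer i + 1.                 *)
Definition dsum (G : nat -> zmodType) : set (forall i, G i) :=
  [set f | finite_set [set i | f i <> 0]].

Definition dsum_add (G : nat -> zmodType) (f g : forall i, G i) :
  forall i, G i := fun i => f i + g i.

Section Domains.
Variable K : fieldType.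
Implicit Types (A D I J M P Q R O S : set K).

Definition subring A : Prop := subring_closed (mem A).

Definition submonoid S : Prop := mulr_closed (mem S).

Definition qfield A : set K := [set a / b | a in A & b in A `\ 0].

Definition localization D S : set K := [set a / s | a in D & s in S].

Definition span A n (g : 'I_n -> K) : set K :=
  [set x | exists a : 'I_n -> K,
     (forall i, A (a i)) /\ x = \sum_(i < n) a i * g i].

Definition submodule A M : Prop :=
  [/\ M 0, forall x y, M x -> M y -> M (x + y)
    & forall a x, A a -> M x -> M (a * x)].

Definition ideal A I : Prop := I `<=` A /\ submodule A I.

Definition prime_ideal A P : Prop :=
  [/\ ideal A P, ~ P 1
    & forall x y, A x -> A y -> P (x * y) -> P x \/ P y].

Definition maximal_ideal A M : Prop :=
  [/\ ideal A M, M <> A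
    & forall I, ideal A I -> M `<=` I -> I = M \/ I = A].

(* Height one: there is a chain of primes of length 1 ending at [P], but none *)
(* of length 2.                                                               *)
Definition height_one A : set (set K) :=
  [set P | [/\ prime_ideal A P,
     exists Q, prime_ideal A Q /\ Q `<` P
   & ~ exists Q0 Q1, [/\ prime_ideal A Q0, prime_ideal A Q1,
                         Q0 `<` Q1 & Q1 `<` P]]].

Definition noetherian A : Prop :=
  forall I, ideal A I -> exists n (g : 'I_n -> K),
    (forall i, I (g i)) /\ I = span A g.

Definition integrally_closed A : Prop :=
  forall x (p : {poly K}), qfield A x ->
    p \is monic -> p \is a polyOver (mem A) -> root p x -> A x.

Definition dedekind D : Prop :=
  [/\ subring D, noetherian D, integrally_closed D
    & forall P, prime_ideal D P -> P <> [set 0] -> maximal_ideal D P].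

Definition idmul I J : set K :=
  [set x | exists n (a b : 'I_n -> K),
     [/\ forall i, I (a i), forall i, J (b i)
       & x = \sum_(i < n) a i * b i]].

(* The existence of a common denominator forces [I `<=` qfield A].            *)
Definition fractional_ideal A I : Prop :=
  submodule A I /\ exists2 d, (A `\ 0) d & forall x, I x -> A (d * x).

Definition invertible A : set (set K) :=
  [set I | fractional_ideal A I /\
     exists2 J, fractional_ideal A J & idmul I J = A].

Definition principal A : set (set K) :=
  [set [set x * a | a in A] | x in qfield A `\ 0].

Definition Pic A : set (set (set K)) :=
  cosets idmul (invertible A) (principal A).

Definition Pic_mul : set (set K) -> set (set K) -> set (set K) :=
  setmul idmul.

Definition order_in R O : Prop :=
  [/\ subring O, O `<=` R, qfield O = qfield R
    & exists n (g : 'I_n -> K), (forall i, R (g i)) /\ R = span O g].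

Definition conductor R O : set K :=
  [set a | R a /\ forall r, R r -> O (a * r)].

Section Residues.
Variable f : set K.

Definition residue (r : K) : set K := [set x | f (x - r)].

(* The elementwise product of two residue classes may be a proper subset of   *)
(* their product in the quotient ring, hence the saturation by [f].           *)
Definition residue_mul (X Y : set K) : set K :=
  [set z | exists x y, [/\ X x, Y y & f (z - x * y)]].

Definition residue_ring A : set (set K) := [set residue a | a in A].

Definition residue_units A : set (set K) :=
  unit_group residue_mul (residue 1) (residue_ring A).

End Residues.

Definition units A : set K := unit_group *%R 1 A.

(* (R/f)^* / (O/f)^*, with operation [setmul (residue_mul f)].                *)
Definition residue_unit_quotient R O f : set (set (set K)) :=
  cosets (residue_mul f) (residue_units f R) (residue_units f O).

(* The image of R^* / O^* under u O^* |-> (u + f) (O/f)^*.                    *)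
Definition unit_image R O f : set (set (set K)) :=
  [set coset (residue_mul f) (residue f u) (residue_units f O)
    | u in units R].

Definition unit_factor_group R O f : set (set (set (set K))) :=
  cosets (setmul (residue_mul f))
    (residue_unit_quotient R O f) (unit_image R O f).

End Domains.

(* Main.v *)
Require Import Defs.
From mathcomp Require Import all_boot all_order all_algebra.
From mathcomp Require Import all_classical.
From mathcomp Require Import ring.

(* Let R be D or a localization D_S. Every nontrivial class of Pic(R) contains
   infinitely many extensions PR of primes P of D: such a class comes from a class
   of Pic(D), all of whose primes avoid S, because primes meeting S extend to R.
   All but finitely many of these primes Q = PR are coprime to the conductor f,
   and then Q /\ O is an invertible prime of O.

   Fix one such Q0 and t in Q0 with t = 1 mod f. If Q = x Q0, then y = t x lies in
   R and is a unit modulo f. If y and y' have the same image in the factor group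
   of (R/f)^* / (O/f)^* modulo R^* / O^*, then Q /\ O and Q' /\ O differ by an
   element of the quotient field. Since this group is finite, infinitely many of
   the Q /\ O lie in one class of Pic(O). Different classes of Pic(R) lead to
   different classes of Pic(O), since Q /\ O generates Q over R. *)

Set Implicit Arguments.
Unset Strict Implicit.
Unset Printing Implicit Defensive.

Import GRing.Theory.
Local Open Scope classical_set_scope.
Local Open Scope ring_scope.

(** * Subrings, ideals and Noetherian induction; primes over a nonzero ideal *)

Section Subrings.
Variable K : fieldType.
Implicit Types (A I J M P : set K).

Lemma subring1 A : subring A -> A 1.
Proof. by case=> + _ _; rewrite inE. Qed.

Lemma subringB A x y : subring A -> A x -> A y -> A (x - y).
Proof.
by case=> _ + _ => /(_ x y) h Ax Ay; move: h; rewrite !inE; apply.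
Qed.

Lemma subringM A x y : subring A -> A x -> A y -> A (x * y).
Proof.
by case=> _ _ /(_ x y) h Ax Ay; move: h; rewrite !inE; apply.
Qed.

Lemma subring0 A : subring A -> A 0.
Proof. by move=> hA; rewrite -(subrr 1); apply: subringB => //; exact: subring1. Qed.

Lemma subringN A x : subring A -> A x -> A (- x).
Proof. by move=> hA Ax; rewrite -sub0r; apply: subringB => //; exact: subring0. Qed.

Lemma subringD A x y : subring A -> A x -> A y -> A (x + y).
Proof.
by move=> hA Ax Ay; rewrite -(opprK y); apply: subringB => //; exact: subringN.
Qed.

Lemma submodule_sum A M n (F : 'I_n -> K) :
  submodule A M -> (forall i, M (F i)) -> M (\sum_(i < n) F i).
Proof. by case=> M0 MD _ MF; elim/big_ind: _. Qed.

Lemma submodule_subring A : subring A -> submodule A A.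
Proof.
move=> hA; split; [exact: subring0|move=> x y; exact: subringD|].
by move=> x y; exact: subringM.
Qed.

Lemma submodule_neq0 A M : submodule A M -> M <> [set 0] -> exists2 x, M x & x != 0.
Proof.
move=> [M0 _ _] Mn0; apply: contrapT => hno; apply: Mn0.
apply/seteqP; split=> [x Mx|_ -> //].
by apply: contrapT => /eqP x0; apply: hno; exists x.
Qed.

Lemma ideal_contraction A B M : subring A -> A `<=` B -> submodule B M ->
  ideal A (M `&` A).
Proof.
move=> hA AB [M0 MD MZ]; split=> [x []//|]; split.
- by split=> //; exact: subring0.
- by move=> x y [Mx Ax] [My Ay]; split; [exact: MD|exact: subringD].
- by move=> a x Aa [Mx Ax]; split; [apply: MZ => //; exact: AB|exact: subringM].
Qed.

Lemma ideal_full A I : ideal A I -> I 1 -> I = A.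
Proof.
move=> [IA [_ _ IZ]] I1; apply/seteqP; split=> // x Ax.
by rewrite -(mulr1 x); exact: IZ.
Qed.

Definition ideal_adjoin A I (c : K) : set K :=
  [set x | exists i a, [/\ I i, A a & x = i + a * c]].

Lemma ideal_adjoinP A I c : subring A -> ideal A I -> A c ->
  [/\ ideal A (ideal_adjoin A I c), I `<=` ideal_adjoin A I c
    & ideal_adjoin A I c c].
Proof.
move=> hA [IA [I0 ID IZ]] Ac; split.
- split=> [_ [i [a [Ii Aa ->]]]|].
    by apply: subringD => //; [exact: IA|exact: subringM].
  split=> [|_ _ [i [a [Ii Aa ->]]] [j [b [Ij Ab ->]]]|b _ Ab [i [a [Ii Aa ->]]]].
  + by exists 0, 0; split=> //; [exact: subring0|ring].
  + by exists (i + j), (a + b); split; [exact: ID|exact: subringD|ring].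
  + by exists (b * i), (b * a); split; [exact: IZ|exact: subringM|ring].
- by move=> i Ii; exists i, 0; split=> //; [exact: subring0|ring].
- by exists 0, 1; split=> //; [exact: subring1|ring].
Qed.

(** Without a maximal member, choice would build an endless strictly increasing chain in [F]. The
    union of the chain is a finitely generated ideal, so its generators already lie in one term and
    the chain stops there. *)
Lemma noetherian_max A (F : set (set K)) I : noetherian A ->
  ideal A I -> F I ->
  exists M, [/\ ideal A M, F M & forall J, ideal A J -> F J -> M `<=` J -> J = M].
Proof.
move=> hN hI FI; apply: contrapT => hno.
(* The premise stands under the existential so that [choice] yields a total function; outside the
   family the value [J] is a dummy. *)
have grow (J : set K) : exists J', ideal A J /\ F J ->
    [/\ ideal A J', F J', J `<=` J' & J' <> J].
  have [[iJ FJ]|?] := EM (ideal A J /\ F J); last by exists J.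
  apply: contrapT => hJ; apply: hno; exists J; split=> // J' iJ' FJ' JJ'.
  by apply: contrapT => neJ; apply: hJ; exists J'.
have {grow} [next nextP] := choice grow.
pose u n := iter n next I.
have uP n : ideal A (u n) /\ F (u n).
  by elim: n => // n IH; have [] := nextP _ IH.
have uS n : u n `<=` u n.+1 by have [] := nextP _ (uP n).
have umono m n : (m <= n)%N -> u m `<=` u n.
  elim: n => [|n IH]; first by rewrite leqn0 => /eqP ->.
  rewrite leq_eqVlt => /orP[/eqP->//|]; rewrite ltnS => /IH h.
  exact: subset_trans h (uS n).
pose U := \bigcup_(n in setT) u n.
have iU : ideal A U.
  split=> [x [n _]|]; first by have [[uA _] _] := uP n; exact: uA.
  split=> [|x y [m _ um] [n _ un]|a x Aa [n _ un]].
  + by exists 0%N => //; have [[_ [u0 _ _]] _] := uP 0%N.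
  + exists (maxn m n) => //; have [[_ [_ uD _]] _] := uP (maxn m n).
    by apply: uD; [apply: umono _ _ um|apply: umono _ _ un]; rewrite ?leq_maxl ?leq_maxr.
  + by exists n => //; have [[_ [_ _ uZ]] _] := uP n; exact: uZ.
have [k [g [Ug UE]]] := hN U iU.
have /choice[m mP] : forall i, exists m, u m (g i).
  by move=> i; have [m _ um] := Ug i; exists m.
pose N := \max_(i < k) m i.
have [_ _ sub ne] := nextP _ (uP N); apply: ne; apply/seteqP; split=> //.
have UN : U `<=` u N.
  rewrite UE => _ [a [Aa ->]]; have [[_ uM] _] := uP N.
  apply: (submodule_sum uM) => i; have [_ _ uZ] := uM.
  by apply: uZ => //; apply: umono _ _ (mP i); exact: leq_bigmax.
by move=> x ux; apply: UN; exists N.+1.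
Qed.

(** An ideal [M] maximal among those containing [I] and avoiding [1] is prime: if [x] is not in [M]
    then [1 = m + a x], whence [y = y m + a (x y)]. *)
Lemma noetherian_prime A I : subring A -> noetherian A -> ideal A I -> ~ I 1 ->
  exists M, prime_ideal A M /\ I `<=` M.
Proof.
move=> hA hN hI I1.
have [M [iM [IM M1] Mmax]] :=
  @noetherian_max A [set J | I `<=` J /\ ~ J 1] I hN hI (conj (@subset_refl _ I) I1).
exists M; split=> //; split=> // x y Ax Ay Mxy.
apply: contrapT => /not_orP[Mx My].
have [iJ MJ Jx] := ideal_adjoinP hA iM Ax.
have [[m [a [Mm Aa e]]]|J1] := EM (ideal_adjoin A M x 1); last first.
  apply: Mx; rewrite -(Mmax _ iJ) //; split=> //; exact: subset_trans IM MJ.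
apply: My; have [_ [_ MD MZ]] := iM.
have -> : y = y * m + a * (x * y) by rewrite -[LHS]mulr1 e; ring.
by apply: MD; apply: MZ.
Qed.

Lemma prime_maximal D P Q : dedekind D -> prime_ideal D P -> prime_ideal D Q ->
  P <> [set 0] -> P `<=` Q -> P = Q.
Proof.
move=> [hD _ _ hmax] pP pQ P0 PQ; have [_ _ mP] := hmax _ pP P0.
have [iQ Q1 _] := pQ; have [<-//|QD] := mP _ iQ PQ.
by case: Q1; rewrite QD; exact: subring1.
Qed.

(** Noetherian induction. Let [M] be maximal among the nonzero ideals lying in infinitely many
    primes. It is not prime, since nonzero primes are maximal, and it is proper. So some [x y] is in
    [M] with [x], [y] outside, and each prime over [M] lies over [M + D x] or [M + D y], both of
    which have only finitely many primes above them. *)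
Lemma dedekind_finite_primes D I : dedekind D -> ideal D I -> I <> [set 0] ->
  finite_set [set P | prime_ideal D P /\ I `<=` P].
Proof.
move=> dD hI I0; apply: contrapT => hinf; have [hD hN _ _] := dD.
pose F := [set J : set K | J <> [set 0] /\
  infinite_set [set P | prime_ideal D P /\ J `<=` P]].
have [M [iM [M0 Minf] Mmax]] := @noetherian_max D F I hN hI (conj I0 hinf).
apply: Minf.
have M_0 : M 0 by case: iM => _ [].
have [pM|npM] := EM (prime_ideal D M).
  apply: sub_finite_set (finite_set1 M) => P [pP MP].
  exact/esym/(prime_maximal dD pM pP M0 MP).
have [M1|M1] := EM (M 1).
  by apply: sub_finite_set (finite_set0 _) => P [[_ + _] /(_ 1 M1)].
have [x [y [Dx Dy Mxy nMx nMy]]] :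
    exists x y, [/\ D x, D y, M (x * y), ~ M x & ~ M y].
  apply: contrapT => hno; apply: npM; split=> // x y Dx Dy Mxy.
  by apply: contrapT => /not_orP[Mx My]; apply: hno; exists x, y.
have adj z : D z -> ~ M z ->
    finite_set [set P | prime_ideal D P /\ ideal_adjoin D M z `<=` P].
  move=> Dz Mz; have [iJ MJ Jz] := ideal_adjoinP hD iM Dz.
  apply: contrapT => Jinf; apply: Mz; rewrite -(Mmax _ iJ) //; split=> // J0.
  apply: M0; apply/seteqP; split; first by rewrite -J0.
  by move=> _ ->.
have sub z P : prime_ideal D P -> M `<=` P -> P z -> ideal_adjoin D M z `<=` P.
  move=> [[_ [_ PD PZ]] _ _] MP Pz _ [m [a [Mm Da ->]]].
  by apply: PD; [exact: MP|exact: PZ].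
have := adj x Dx nMx; have := adj y Dy nMy.
move=> fy fx; have := conj fx fy; rewrite -finite_setU; apply: sub_finite_set.
move=> P [pP MP]; have [_ _ /(_ x y Dx Dy (MP _ Mxy))[Px|Py]] := pP.
  by left; split=> //; exact: sub.
by right; split=> //; exact: sub.
Qed.

End Subrings.

(** * Invertibility of nonzero ideals of a Dedekind domain *)

Section InvertibleIdeals.
Variable K : fieldType.
Implicit Types (A D I J M P Q R : set K).

Lemma char_poly_over D n (A : 'M[K]_n) : subring D ->
  (forall i j, D (A i j)) -> char_poly A \is a polyOver (mem D).
Proof.
move=> hD DA; pose Dp (p : {poly K}) := forall i, D p`_i.
have DpC c : D c -> Dp c%:P.
  by move=> Dc i; rewrite coefC; case: ifP => // _; exact: subring0.
have DpN p : Dp p -> Dp (- p).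
  by move=> h i; rewrite coefN; apply: subringN.
have DpD p q : Dp p -> Dp q -> Dp (p + q).
  by move=> hp hq i; rewrite coefD; apply: subringD.
have DpM p q : Dp p -> Dp q -> Dp (p * q).
  move=> hp hq i; rewrite coefM; apply: submodule_sum (submodule_subring hD) _.
  by move=> j; apply: subringM.
have Dp0 : Dp 0 by apply: DpC; exact: subring0.
have Dp1 : Dp 1 by apply: DpC; exact: subring1.
have DpX : Dp 'X.
  move=> i; rewrite coefX; case: (i == 1%N); [exact: subring1|exact: subring0].
suff h : Dp (char_poly A).
  by rewrite qualifE; apply/(all_nthP 0) => i _; rewrite /= inE; exact: h.
rewrite /char_poly /determinant; elim/big_ind: _ => // s _; apply/DpM.
  by elim: (nat_of_bool _) => [|k IH]; rewrite ?expr0 // exprS; apply/DpM/IH/DpN.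
elim/big_ind: _ => // i _; rewrite !mxE; apply/DpD.
  by case: (_ == _); rewrite ?mulr1n ?mulr0n.
exact/DpN/DpC.
Qed.

(** Determinant trick: the [g i] form an eigenvector with eigenvalue [c] of a matrix over [D], so
    [c] is a root of a monic polynomial over [D]. *)
Lemma integral_of_stable_module D n (g : 'I_n -> K) c : subring D ->
  integrally_closed D -> qfield D c -> (exists i, g i != 0) ->
  (forall i, Defs.span D g (c * g i)) -> D c.
Proof.
move=> hD hint Dc [i0 gi0] hspan.
have /choice[a aP] : forall i, exists a : 'I_n -> K,
  (forall j, D (a j)) /\ c * g i = \sum_j a j * g j by [].
(* The matrix is transposed because eigenvectors are row vectors here. *)
pose A := \matrix_(i, j) a j i.
have DA i j : D (A i j) by rewrite mxE; have [] := aP j.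
apply: hint (char_poly_monic A) (char_poly_over hD DA) _ => //.
rewrite -eigenvalue_root_char; apply/eigenvalueP; exists (\row_i g i).
  apply/rowP => j; rewrite !mxE; have [_ ->] := aP j.
  by apply: eq_bigr => i _; rewrite !mxE mulrC.
by apply/eqP => /rowP/(_ i0); rewrite !mxE; exact/eqP.
Qed.

(** The ideal quotient [(A : I)] in [K]; it is the inverse of [I] whenever [I] has one. *)
Definition colon A I : set K := [set x | forall i, I i -> A (x * i)].

Lemma submodule_idmul A I J : subring A -> submodule A I -> submodule A (idmul I J).
Proof.
move=> hA [I0 ID IZ]; split.
- exists 0%N, (fun=> 0), (fun=> 0); split; [by case|by case|by rewrite big_ord0].
- move=> _ _ [m [a [b [Ia Jb ->]]]] [n [a' [b' [Ia' Jb' ->]]]].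
  exists (m + n)%N,
    (fun i => match fintype.split i with inl j => a j | inr j => a' j end),
    (fun i => match fintype.split i with inl j => b j | inr j => b' j end); split.
  + by move=> i; case: (fintype.split i).
  + by move=> i; case: (fintype.split i).
  + rewrite big_split_ord /=; congr (_ + _); apply: eq_bigr => i _.
      by have /= -> := unsplitK (inl _ i).
    by have /= -> := unsplitK (inr _ i).
- move=> x _ Ax [m [a [b [Ia Jb ->]]]]; exists m, (fun i => x * a i), b; split=> //.
    by move=> i; apply: IZ.
  by rewrite mulr_sumr; apply: eq_bigr => i _; rewrite mulrA.
Qed.

Lemma idmul_sub A I J : subring A -> (forall i j, I i -> J j -> A (i * j)) ->
  idmul I J `<=` A.
Proof.
move=> hA IJA _ [n [a [b [Ia Jb ->]]]].
by apply: submodule_sum (submodule_subring hA) _ => i; exact: IJA.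
Qed.

Lemma mem_idmul I J x y : I x -> J y -> idmul I J (x * y).
Proof.
by move=> Ix Jy; exists 1%N, (fun=> x), (fun=> y); split=> //; rewrite big_ord1.
Qed.

Lemma ideal_idmul_colon A I : subring A -> submodule A I ->
  ideal A (idmul I (colon A I)).
Proof.
move=> hA hI; split; last exact: submodule_idmul.
by apply: idmul_sub => // i x Ii; rewrite mulrC; exact.
Qed.

Lemma submodule_colon A I : subring A -> submodule A (colon A I).
Proof.
move=> hA; split.
- by move=> i _; rewrite mul0r; exact: subring0.
- by move=> x y xI yI i Ii; rewrite mulrDl; apply: subringD; [|exact: xI|exact: yI].
- by move=> a x Aa xI i Ii; rewrite -mulrA; apply: subringM => //; exact: xI.
Qed.

(** Reduces invertibility to one membership: any nonzero [d] in [I] is a common denominator of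
    [colon A I], which is therefore a fractional ideal. *)
Lemma invertible_colon A I : subring A -> ideal A I -> I <> [set 0] ->
  idmul I (colon A I) 1 -> invertible A I.
Proof.
move=> hA iI In0 h1; have [IA mI] := iI.
have [d Id /eqP d0] := submodule_neq0 mI In0.
split; first split=> //.
  exists 1; first by split; [exact: subring1|exact/eqP/oner_neq0].
  by move=> x Ix; rewrite mul1r; exact: IA.
exists (colon A I).
  split; first exact: submodule_colon.
  by exists d; [split=> //; exact: IA|move=> x /(_ d Id); rewrite mulrC].
exact: ideal_full (ideal_idmul_colon hA mI) h1.
Qed.

(* [M] is an associated prime of a principal ideal [aD], say [M = (aD : b)];
   then [c = b / a] is not in [D], whereas [c * I^-1 <= I^-1] would make it
   integral. *)
Lemma dedekind_colon D I : dedekind D -> ideal D I -> I <> [set 0] ->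
  idmul I (colon D I) 1.
Proof.
move=> dD iI In0; have [hD hN hint hmax] := dD; have [ID mI] := iI.
have [d Id d0] := submodule_neq0 mI In0.
apply: contrapT => h1.
have [M [pM TM]] := noetherian_prime hD hN (ideal_idmul_colon hD mI) h1.
have Md : M d.
  apply: TM; rewrite -(mulr1 d); apply: mem_idmul => // i Ii.
  by rewrite mul1r; exact: ID.
(* [quo b] is the ideal [(dD : b)]. Among those contained in [M] a maximal one is chosen below and
   shown to be prime. *)
pose quo b := [set x | D x /\ exists2 r, D r & x * b = d * r].
have quo_ideal b : ideal D (quo b).
  split=> [x []//|]; split.
  - split; [exact: subring0|exists 0; [exact: subring0|ring]].
  - move=> x y [Dx [r Dr xr]] [Dy [s Ds ys]]; split; first exact: subringD.
    by exists (r + s); [exact: subringD|rewrite mulrDl xr ys; ring].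
  - move=> a x Da [Dx [r Dr xr]]; split; first exact: subringM.
    by exists (a * r); [exact: subringM|rewrite -mulrA xr; ring].
pose F := [set J | exists b, [/\ D b, J = quo b & J `<=` M]].
have [iM M1 MP] := pM; have [MD [_ _ MZ]] := iM.
have F1 : F (quo 1).
  exists 1; split=> //; first exact: subring1.
  by move=> x [_ [r Dr]]; rewrite mulr1 mulrC => ->; exact: MZ.
have [N [iN [b [Db NE NM]] Nmax]] := noetherian_max hN (quo_ideal 1) F1.
have pN : prime_ideal D N.
  split=> // [/NM//|x y Dx Dy Nxy].
  apply: contrapT => /not_orP[Nx Ny].
  (* [quo (b * s)] contains [quo b]. If [s] is outside the prime [M], it still lies in [M], so
     maximality gives equality. *)
  have satur s : D s -> ~ M s -> quo (b * s) = N.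
    move=> Ds Ms; apply: Nmax => //.
      exists (b * s); split=> //; first exact: subringM.
      move=> r [Dr [e De re]].
      have : M (r * s).
        apply: NM; rewrite NE; split; first exact: subringM.
        by exists e => //; rewrite -re; ring.
      by move=> /(MP _ _ Dr Ds)[].
    rewrite NE => r [Dr [e De re]]; split=> //; exists (e * s); first exact: subringM.
    by rewrite mulrA re; ring.
  (* If no such [s] existed, [quo (b * z)] would lie in [M], hence equal [N] by maximality; but it
     contains [w]. *)
  have sub_sat z w : D z -> D w -> N (z * w) -> ~ N w ->
      exists2 s, D s /\ ~ M s & N (s * z).
    move=> Dz Dw Nzw Nw.
    have qz : ideal D (quo (b * z)) by exact: quo_ideal.
    apply: contrapT => hno; apply: Nw.
    have -> : N = quo (b * z).
      apply/esym/Nmax => //.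
        exists (b * z); split=> //; first exact: subringM.
        move=> s [Ds [e De se]]; apply: contrapT => Ms; apply: hno; exists s => //.
        rewrite NE; split; first exact: subringM.
        by exists e => //; rewrite -se; ring.
      rewrite NE => r [Dr [e De re]]; split=> //; exists (e * z); first exact: subringM.
      by rewrite mulrA re; ring.
    move: Nzw; rewrite NE => -[_ [e De zwe]]; split=> //; exists e => //.
    by rewrite -zwe; ring.
  have [s [Ds Ms] Nsx] := sub_sat x y Dx Dy Nxy Ny.
  apply: Nx; rewrite -(satur s Ds Ms); split=> //.
  by move: Nsx; rewrite NE => -[_ [e De sxe]]; exists e => //; rewrite -sxe; ring.
have Nd : N d by rewrite NE; split; [exact: ID|exists b].
have N0 : N <> [set 0] by move=> N0; move: Nd; rewrite N0 /= => /eqP; rewrite (negbTE d0).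
have NME : N = M := prime_maximal dD pN pM N0 NM.
pose c := b / d.
have cM x : M x -> D (c * x).
  rewrite -NME NE => -[_ [e De xbe]]; suff -> : c * x = e by [].
  by apply: (mulfI d0); rewrite -xbe /c; field.
have ncD : ~ D c.
  move=> Dc; apply: M1; rewrite -NME NE; split; first exact: subring1.
  by exists c => //; rewrite /c; field.
apply: ncD.
(* [J] is an ideal of [D], hence finitely generated. It is stable under [c] because [I (D : I)] lies
   in [M] and [c M] lies in [D]. *)
pose J := [set d * x | x in colon D I].
have iJ : ideal D J.
  split=> [_ [x xI <-]|]; first by rewrite mulrC; exact: xI.
  have [C0 CD CZ] := submodule_colon I hD; split.
  - by exists 0 => //; rewrite mulr0.
  - by move=> _ _ [x xI <-] [y yI <-]; exists (x + y); [exact: CD|ring].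
  - by move=> a _ Da [x xI <-]; exists (a * x); [exact: CZ|ring].
have [n [g [Jg JE]]] := hN J iJ.
apply: (@integral_of_stable_module D n g) => //.
- by exists b => //; exists d => //; split; [exact: ID|exact/eqP].
- apply: contrapT => hno; have : J d.
    by exists 1; [move=> i Ii; rewrite mul1r; exact: ID|rewrite mulr1].
  rewrite JE => -[a [_ dE]]; move: d0; rewrite dE big1 ?eqxx // => i _.
  have -> : g i = 0 by apply: contrapT => /eqP gi; apply: hno; exists i.
  by rewrite mulr0.
- move=> i; rewrite -JE; have [x xI <-] := Jg i.
  exists (c * x); last by ring.
  move=> k Ik; rewrite -mulrA; apply: cM; apply: TM; rewrite mulrC.
  exact: mem_idmul.
Qed.

End InvertibleIdeals.

(** * Ideal classes as orbits under scaling *)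

Section IdealClasses.
Variable K : fieldType.
Implicit Types (A I J : set K).

Definition scale (x : K) I : set K := [set x * i | i in I].

Lemma scaleA x y I : scale x (scale y I) = scale (x * y) I.
Proof.
apply/seteqP; split=> [_ [_ [i Ii <-] <-]|_ [i Ii <-]].
  by exists i => //; rewrite mulrA.
by exists (y * i); [exists i|rewrite mulrA].
Qed.

Lemma scale1 I : scale 1 I = I.
Proof.
apply/seteqP; split=> [_ [i Ii <-]|i Ii]; first by rewrite mul1r.
by exists i => //; rewrite mul1r.
Qed.

Lemma scaleVK x I : x != 0 -> scale x^-1 (scale x I) = I.
Proof. by move=> x0; rewrite scaleA mulVf// scale1. Qed.

Lemma submodule_scale A I x : submodule A I -> submodule A (scale x I).
Proof.
move=> [I0 ID IZ]; split.
- by exists 0 => //; rewrite mulr0.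
- by move=> _ _ [i Ii <-] [j Ij <-]; exists (i + j); [exact: ID|exact: mulrDr].
- by move=> a _ Aa [i Ii <-]; exists (a * i); [exact: IZ|rewrite mulrCA].
Qed.

Lemma idmul_scale A I x : subring A -> submodule A I ->
  idmul I (scale x A) = scale x I.
Proof.
move=> hA mI; apply/seteqP; split=> [_ [n [a [b [Ia xb ->]]]]|_ [i Ii <-]].
  apply: (submodule_sum (submodule_scale x mI)) => i; have [r Ar <-] := xb i.
  by exists (r * a i); [have [_ _ IZ] := mI; exact: IZ|ring].
rewrite mulrC; apply: mem_idmul => //.
by exists 1; [exact: subring1|exact: mulr1].
Qed.

Lemma qfield_units1 A : subring A -> (qfield A `\ 0) 1.
Proof.
move=> hA; split; last exact/eqP/oner_neq0.
exists 1; first exact: subring1.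
by exists 1; [split; [exact: subring1|exact/eqP/oner_neq0]|rewrite divr1].
Qed.

Lemma qfield_unitsM A x y : subring A ->
  (qfield A `\ 0) x -> (qfield A `\ 0) y -> (qfield A `\ 0) (x * y).
Proof.
move=> hA [[a Aa [b [Ab /eqP b0] <-]] /eqP x0] [[c Ac [d [Ad /eqP d0] <-]] /eqP y0].
split; last exact/eqP/mulf_neq0.
exists (a * c); first exact: subringM.
exists (b * d); first by split; [exact: subringM|exact/eqP/mulf_neq0].
by rewrite mulf_div.
Qed.

Lemma qfield_unitsV A x : (qfield A `\ 0) x -> (qfield A `\ 0) x^-1.
Proof.
move=> [[a Aa [b [Ab /eqP b0] <-]] /eqP x0].
split; last exact/eqP/invr_neq0.
exists b => //; exists a; last by rewrite invf_div.
by split=> //= a0; move: x0; rewrite a0 mul0r eqxx.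
Qed.

Lemma mem_qfield A x : subring A -> A x -> qfield A x.
Proof.
move=> hA Ax; exists x => //; exists 1; last by rewrite divr1.
by split; [exact: subring1|exact/eqP/oner_neq0].
Qed.

Definition ideal_class A I : set (set K) := coset (@idmul K) I (principal A).

(** Multiplying by a principal ideal is scaling by its generator, so comparisons of classes become
    equalities up to a scalar. *)
Lemma ideal_classP A I J : subring A -> submodule A I ->
  ideal_class A I J <-> exists2 x, (qfield A `\ 0) x & J = scale x I.
Proof.
move=> hA mI; split=> [[_ [x Ax <-] <-]|[x Ax ->]].
  by exists x => //; exact: idmul_scale.
by exists (scale x A); [exists x|exact: idmul_scale].
Qed.

Lemma mem_ideal_class A I : subring A -> submodule A I -> ideal_class A I I.
Proof.
move=> hA mI; apply/ideal_classP => //; exists 1; last by rewrite scale1.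
exact: qfield_units1.
Qed.

Lemma ideal_class_scale A I x : subring A -> submodule A I -> (qfield A `\ 0) x ->
  ideal_class A (scale x I) = ideal_class A I.
Proof.
move=> hA mI Ax; have mxI := submodule_scale x mI; have /eqP x0 := Ax.2.
apply/seteqP; split=> J /ideal_classP[]// y Ay ->; apply/ideal_classP => //.
  by exists (y * x); [exact: qfield_unitsM|rewrite scaleA].
exists (y * x^-1); last by rewrite scaleA mulfVK.
by apply: qfield_unitsM => //; exact: qfield_unitsV.
Qed.

Lemma Pic_ideal_class A I : invertible A I -> Pic A (ideal_class A I).
Proof. by exists I. Qed.

Lemma Pic_rep A c : Pic A c -> exists2 I, invertible A I & c = ideal_class A I.
Proof. by move=> [I invI <-]; exists I. Qed.

Lemma invertible_neq0 A I : subring A -> invertible A I -> exists2 x, I x & x != 0.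
Proof.
move=> hA [_ [J _ IJ]]; apply: contrapT => hno; have := subring1 hA.
rewrite -IJ => -[n [a [b [Ia _ e]]]]; have /eqP := oner_neq0 K; apply.
rewrite e big1// => i _; have -> : a i = 0; last by rewrite mul0r.
by apply: contrapT => /eqP ai0; apply: hno; exists (a i).
Qed.

End IdealClasses.

(** * Contraction of ideals from [R] to an order *)

Section Orders.
Variables (K : fieldType) (R O : set K).
Hypotheses (hR : subring R) (hO : subring O) (OR : O `<=` R).
Implicit Types (M Q : set K).

Local Notation f := (conductor R O).

Lemma conductor_ideal : ideal R f.
Proof.
split=> [x []//|]; split.
- by split=> [|r _]; [exact: subring0|rewrite mul0r; exact: subring0].
- move=> x y [Rx fx] [Ry fy]; split=> [|r Rr]; first exact: subringD.
  rewrite mulrDl; apply: subringD => //; [exact: fx|exact: fy].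
- move=> a x Ra [Rx fx]; split=> [|r Rr]; first exact: subringM.
  have -> : a * x * r = x * (a * r) by ring.
  by apply: fx; exact: subringM.
Qed.

Lemma conductor_sub : f `<=` O.
Proof. by move=> x [_ /(_ 1 (subring1 hR))]; rewrite mulr1. Qed.

Lemma conductorD x y : f x -> f y -> f (x + y).
Proof. by have [_ [_ fD _]] := conductor_ideal; exact: fD. Qed.

Lemma conductorMl a x : R a -> f x -> f (a * x).
Proof. by have [_ [_ _ fZ]] := conductor_ideal; exact: fZ. Qed.

Lemma conductorMr a x : R a -> f x -> f (x * a).
Proof. by rewrite mulrC; exact: conductorMl. Qed.

Lemma conductorN x : f x -> f (- x).
Proof.
move=> fx; rewrite -mulN1r; apply: conductorMl => //.
by apply: subringN => //; exact: subring1.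
Qed.

(** Here [w] inverts [v] modulo the conductor. From [v m] in [O] one recovers
    [m = w (v m) - (v w - 1) m], whose last term lies in the conductor. *)
Lemma scale_contraction v w M : O v -> O w -> f (v * w - 1) -> M `<=` R ->
  submodule R M -> scale v (M `&` O) = scale v M `&` O.
Proof.
move=> Ov Ow fvw MR [_ _ MZ]; apply/seteqP; split=> [_ [m [Mm Om] <-]|_ [[m Mm <-] Ovm]].
  by split; [exists m|exact: subringM].
exists m => //; split=> //; have -> : m = w * (v * m) - (v * w - 1) * m by ring.
apply: subringB => //; first exact: subringM.
by apply/conductor_sub/conductorMr => //; exact: MR.
Qed.

Lemma prime_contraction Q : prime_ideal R Q -> prime_ideal O (Q `&` O).
Proof.
move=> [[_ mQ] Q1 QP]; split; first exact: ideal_contraction mQ.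
- by case.
- move=> x y Ox Oy [Qxy _]; have [?|?] := QP x y (OR Ox) (OR Oy) Qxy.
    by left.
  by right.
Qed.

(** Comaximality [Q + f = R], kept as a witness [s]; such an [s] lies in [O] as well. *)
Definition coprime_conductor Q := exists2 s, Q s & f (1 - s).

Lemma coprime_conductor_mem Q s : Q s -> f (1 - s) -> (Q `&` O) s.
Proof.
move=> Qs fs; split=> //; have -> : s = 1 - (1 - s) by ring.
by apply: subringB => //; [exact: subring1|exact: conductor_sub].
Qed.

(** If the given witness is [0], the conductor contains [1], and any nonzero element of [Q]
    serves. *)
Lemma coprime_conductor_neq0 Q x : ideal R Q -> Q x -> x != 0 -> coprime_conductor Q ->
  exists s, [/\ Q s, s != 0 & f (1 - s)].
Proof.
move=> [QR [_ _ QZ]] Qx x0 [s Qs fs]; have [s0|s0] := eqVneq s 0; last by exists s.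
exists x; split=> //; rewrite -(mulr1 (1 - x)); apply: conductorMl.
  by apply: subringB => //; [exact: subring1|exact: QR].
by move: fs; rewrite s0 subr0.
Qed.

(** [Q] is generated over [R] by its contraction: in [q = q s + (1 - s) q] both [s] and [(1 - s) q]
    lie in [Q] and in [O]. *)
Lemma scale_sub_of_contraction x Q Q' : ideal R Q -> submodule R Q' ->
  coprime_conductor Q -> Q `&` O `<=` scale x (Q' `&` O) -> Q `<=` scale x Q'.
Proof.
move=> [QR [_ _ QZ]] mQ' [s Qs fs] sub q Qq.
have [_ Q'D Q'Z] := submodule_scale x mQ'.
have up z : (Q `&` O) z -> scale x Q' z by move=> /sub[z' [? _] <-]; exists z'.
have -> : q = q * s + (1 - s) * q by ring.
apply: Q'D; first by apply: Q'Z; [exact: QR|apply: up; exact: coprime_conductor_mem].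
apply: up; split; first by apply: QZ => //; have [] := fs.
by apply/conductor_sub/conductorMr => //; exact: QR.
Qed.

Lemma eq_of_contraction (x : K) Q Q' : x != 0 -> ideal R Q -> ideal R Q' ->
  coprime_conductor Q -> coprime_conductor Q' ->
  Q `&` O = scale x (Q' `&` O) -> Q = scale x Q'.
Proof.
move=> x0 iQ iQ' cQ cQ' e; apply/seteqP; split.
  by apply: scale_sub_of_contraction => //; [exact: iQ'.2|rewrite e].
have : Q' `<=` scale x^-1 Q.
  apply: scale_sub_of_contraction => //; first exact: iQ.2.
  by rewrite e scaleVK.
by move=> sub _ [q' /sub[q Qq <-] <-]; rewrite mulVKf.
Qed.

(* If [1 = s + t] with [s] in [Q] and [t] in the conductor, then
   [t^2] lies in [(t Q) (t Q^-1)], and [1 = s (s + 2 t) + t^2]. *)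
Lemma invertible_contraction Q x : ideal R Q -> Q x -> x != 0 ->
  (exists2 y, f y & y != 0) -> coprime_conductor Q ->
  idmul Q (colon R Q) 1 -> invertible O (Q `&` O).
Proof.
move=> iQ Qx x0 [y fy y0] [s Qs fs] [n [a [b [Qa Qb e]]]].
have [QR [_ _ QZ]] := iQ; have iQO := ideal_contraction hO OR iQ.2.
apply: invertible_colon => //.
  move=> QO0; have : (Q `&` O) (y * x).
    split; first by apply: QZ => //; have [] := fy.
    by apply/conductor_sub/conductorMr => //; exact: QR.
  by rewrite QO0 /= => /eqP; rewrite mulf_eq0 (negbTE x0) (negbTE y0).
have [_ [_ TD TZ]] := ideal_idmul_colon hO iQO.2.
pose t := 1 - s; have Ot : O t by exact: conductor_sub.
have [QOs Os] := coprime_conductor_mem Qs fs.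
have -> : 1 = (s + t * 2) * (s * 1) + t ^+ 2 by rewrite /t; ring.
apply: TD.
  apply: TZ.
    apply: subringD => //; apply: subringM => //.
    by rewrite mulr2n; apply: subringD => //; exact: subring1.
  by apply: mem_idmul => // z [_ Oz]; rewrite mul1r.
exists n, (fun i => t * a i), (fun i => t * b i); split.
- move=> i; split; first by apply: QZ; [exact: OR|].
  by apply/conductor_sub/conductorMr => //; exact: QR.
- move=> i z [Qz Oz]; rewrite -mulrA; apply/conductor_sub/conductorMr => //.
  exact: Qb.
- rewrite -[LHS]mulr1 e mulr_sumr; apply: eq_bigr => i _; ring.
Qed.

(** * Residue classes modulo the conductor and the factor group of their units *)

Definition unit_factor_class (y : K) : set (set (set K)) :=
  coset (setmul (residue_mul f))
    (coset (residue_mul f) (residue f y) (residue_units f O)) (unit_image R O f).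

Lemma residue_refl x : residue f x x.
Proof. by rewrite /residue /= subrr; have [_ []] := conductor_ideal. Qed.

Lemma residue_mulE x y : R x -> R y ->
  residue_mul f (residue f x) (residue f y) = residue f (x * y).
Proof.
move=> Rx Ry; apply/seteqP; split=> z.
  move=> [x' [y' [fx fy fz]]]; rewrite /residue /= in fx fy *.
  have Rx' : R x' by rewrite -(subrK x x'); apply: subringD => //; have [] := fx.
  have -> : z - x * y = (z - x' * y') + ((x' - x) * y + x' * (y' - y)) by ring.
  by apply: conductorD => //; apply: conductorD; [exact: conductorMr|exact: conductorMl].
by move=> fz; exists x, y; split=> //; exact: residue_refl.
Qed.

Lemma residue_eq x y : residue f x = residue f y -> f (x - y).
Proof. by move=> e; have := residue_refl x; rewrite e. Qed.

Lemma eq_residue x y : f (x - y) -> residue f x = residue f y.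
Proof.
move=> fxy; apply/seteqP; split=> z; rewrite /residue /= => fz.
  have -> : z - y = (z - x) + (x - y) by ring.
  exact: conductorD.
have -> : z - x = (z - y) + - (x - y) by ring.
by apply: conductorD => //; exact: conductorN.
Qed.

Lemma residue_unitsP A X : subring A -> A `<=` R -> residue_units f A X ->
  exists w w', [/\ A w, A w', X = residue f w & f (w * w' - 1)].
Proof.
move=> hA AR [[w Aw <-] [_ [w' Aw' <-]]].
rewrite residue_mulE; [|exact: AR|exact: AR] => /residue_eq fww.
by exists w, w'.
Qed.

Lemma mem_residue_units A w w' : A `<=` R -> A w -> A w' -> f (w * w' - 1) ->
  residue_units f A (residue f w).
Proof.
move=> AR Aw Aw' fww; split; first by exists w.
exists (residue f w'); first by exists w'.
by rewrite residue_mulE; [exact: eq_residue|exact: AR|exact: AR].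
Qed.

Lemma mem_unit_factor_group y z : R y -> R z -> f (y * z - 1) ->
  unit_factor_group R O f (unit_factor_class y).
Proof.
move=> Ry Rz fyz; exists (coset (residue_mul f) (residue f y) (residue_units f O)) => //.
exists (residue f y) => //; exact: mem_residue_units fyz.
Qed.

Lemma units_one : units R 1.
Proof. by split; [exact: subring1|exists 1; [exact: subring1|exact: mulr1]]. Qed.

Lemma residue_units_one : residue_units f O (residue f 1).
Proof.
apply: (@mem_residue_units O 1 1) => //; try exact: subring1.
by rewrite mulr1 subrr; have [_ []] := conductor_ideal.
Qed.

(** Taking trivial units shows that the residue of [y'] lies in a coset belonging to the class of
    [y'], hence to that of [y]. Unfolding the latter gives [u] and one unit of [O] modulo the
    conductor from each of two cosets, those of [y] and of [u]; [w] is their product. *)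
Lemma unit_factor_class_eq y y' : R y -> R y' ->
  unit_factor_class y = unit_factor_class y' ->
  exists u w w', [/\ units R u, O w, O w', f (w * w' - 1) & f (y' - y * u * w)].
Proof.
move=> Ry Ry' e.
have R1 := subring1 hR.
pose Y := coset (residue_mul f) (residue f y') (residue_units f O).
pose U1 := coset (residue_mul f) (residue f 1) (residue_units f O).
have : unit_factor_class y' (setmul (residue_mul f) Y U1).
  by exists U1 => //; exists 1 => //; exact: units_one.
rewrite -e => -[_ [u Ru <-]] eY.
have : setmul (residue_mul f) Y U1 (residue f y').
  exists (residue f y').
    by exists (residue f 1); [exact: residue_units_one|rewrite residue_mulE ?mulr1].
  exists (residue f 1); last by rewrite residue_mulE ?mulr1.
  by exists (residue f 1); [exact: residue_units_one|rewrite residue_mulE ?mulr1].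
rewrite -eY => -[_ [X1 /residue_unitsP[]// w1 [w1' [Ow1 Ow1' -> f1]] <-]].
move=> [_ [X2 /residue_unitsP[]// w2 [w2' [Ow2 Ow2' -> f2]] <-]].
have Ru1 := Ru.1; have Rw1 := OR Ow1; have Rw2 := OR Ow2.
rewrite !residue_mulE //; try exact: subringM.
move=> /esym/residue_eq fy.
exists u, (w1 * w2), (w1' * w2'); split=> //; try exact: subringM.
  have -> : w1 * w2 * (w1' * w2') - 1
    = (w1 * w1' - 1) * (w2 * w2') + (w2 * w2' - 1) by ring.
  apply: conductorD => //; apply: conductorMr => //.
  by apply: OR; exact: subringM.
by have -> : y' - y * u * (w1 * w2) = y' - y * w1 * (u * w2) by ring.
Qed.

(* Scaling [Q] by [z * u^-1 * y'] and [Q'] by [z * y] gives the same ideal of [R],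
   and both factors lie in [O] and are units modulo the conductor. *)
Lemma contraction_class_eq y y' z Q Q' : R y -> R y' -> R z ->
  y != 0 -> y' != 0 -> z != 0 -> f (y * z - 1) ->
  ideal R Q -> ideal R Q' -> scale y' Q = scale y Q' ->
  unit_factor_class y = unit_factor_class y' ->
  ideal_class O (Q `&` O) = ideal_class O (Q' `&` O).
Proof.
move=> Ry Ry' Rz y0 y'0 z0 fyz iQ iQ' eQ ey.
have [u [w [w' [[Ru [u' Ru' uu'] Ow Ow' fww fy]]]]] := unit_factor_class_eq Ry Ry' ey.
have Of a b : O b -> f (a - b) -> O a.
  by move=> Ob fab; rewrite -(subrK b a); apply: subringD => //; exact: conductor_sub.
(* Modulo the conductor [v] is [1] and [v'] is [w]; here [u'] is the inverse of [u]. *)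
pose v := z * y; pose v' := z * u' * y'.
have fv : f (v - 1) by rewrite /v mulrC.
have Ov : O v by apply: Of fv; exact: subring1.
have fv' : f (v' - w).
  have -> : v' - w = z * u' * (y' - y * u * w) + (y * z - 1) * w.
    have -> : z * u' * (y' - y * u * w) = v' - z * y * (u * u') * w by rewrite /v'; ring.
    by rewrite uu'; ring.
  apply: conductorD; first by apply: conductorMl => //; exact: subringM.
  by apply: conductorMr => //; exact: OR.
have Ov' : O v' by exact: Of fv'.
have u'0 : u' != 0 by apply/eqP => u'0; move/eqP: uu'; rewrite u'0 mulr0 eq_sym oner_eq0.
have v0 : v != 0 by rewrite mulf_neq0.
have v'0 : v' != 0 by rewrite !mulf_neq0.
have scaleu' : scale u' Q' = Q'.
  have [_ [_ _ Q'Z]] := iQ'.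
  apply/seteqP; split=> [_ [q Qq <-]|q Qq]; first exact: Q'Z.
  by exists (u * q); [exact: Q'Z|rewrite mulrA [u' * u]mulrC uu' mul1r].
have e : scale v' (Q `&` O) = scale v (Q' `&` O).
  rewrite (@scale_contraction v' w') //; [|..|exact: iQ.1|exact: iQ.2]; last first.
    have -> : v' * w' - 1 = (v' - w) * w' + (w * w' - 1) by ring.
    by apply: conductorD => //; apply: conductorMr => //; exact: OR.
  rewrite (@scale_contraction v 1) //;
    [|exact: subring1|by rewrite mulr1|exact: iQ'.1|exact: iQ'.2].
  by rewrite /v' -scaleA eQ scaleA mulrAC -scaleA scaleu'.
have mQO M : ideal R M -> submodule O (M `&` O).
  by case=> _ mM; exact: (ideal_contraction _ OR mM).2.
have qv a : O a -> a != 0 -> (qfield O `\ 0) a.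
  by move=> Oa a0; split; [exact: mem_qfield|exact/eqP].
rewrite -(ideal_class_scale hO (mQO _ iQ) (qv _ Ov' v'0)) e.
by rewrite ideal_class_scale //; [exact: mQO|exact: qv].
Qed.

End Orders.

(** * Ideals and primes under localization *)

Section Localization.
Variables (K : fieldType) (D S : set K).
Hypotheses (hD : subring D) (hS : submonoid S) (SD : S `<=` D `\ 0).
Implicit Types (I J P : set K).

Local Notation R := (localization D S).
Local Notation ext J := (localization J S).

Lemma submonoid1 : S 1.
Proof. by case: hS => + _; rewrite inE. Qed.

Lemma submonoidM s t : S s -> S t -> S (s * t).
Proof. by case: hS => _ /(_ s t) h Ss St; move: h; rewrite !inE; apply. Qed.

Lemma submonoid_neq0 s : S s -> s != 0.
Proof. by move=> /SD[_ /eqP]. Qed.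

Lemma submonoid_mem s : S s -> D s.
Proof. by move=> /SD[]. Qed.

Lemma sub_localization J : J `<=` ext J.
Proof. by move=> x Jx; exists x => //; exists 1; [exact: submonoid1|rewrite divr1]. Qed.

Lemma localizationS I J : I `<=` J -> ext I `<=` ext J.
Proof. by move=> IJ _ [a Ia [s Ss <-]]; exists a; [exact: IJ|exists s]. Qed.

Lemma localization_subring : subring R.
Proof.
split.
- by rewrite inE; apply: sub_localization; exact: subring1.
- move=> x y; rewrite !inE => -[a Da [s Ss <-]] [b Db [t St <-]].
  have s0 := submonoid_neq0 Ss; have t0 := submonoid_neq0 St.
  have Ds := submonoid_mem Ss; have Dt := submonoid_mem St.
  exists (a * t - b * s); first by apply: subringB => //; exact: subringM.
  exists (s * t); first exact: submonoidM.
  by field; rewrite s0 t0.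
- move=> x y; rewrite !inE => -[a Da [s Ss <-]] [b Db [t St <-]].
  exists (a * b); first exact: subringM.
  exists (s * t); first exact: submonoidM.
  by rewrite mulf_div.
Qed.

Lemma localization_ideal J : ideal D J -> ideal R (ext J).
Proof.
move=> [JD [J0 JD' JZ]]; split; first exact: localizationS.
split.
- exact: sub_localization.
- move=> _ _ [a Ja [s Ss <-]] [b Jb [t St <-]].
  have s0 := submonoid_neq0 Ss; have t0 := submonoid_neq0 St.
  have Ds := submonoid_mem Ss; have Dt := submonoid_mem St.
  exists (t * a + s * b); first by apply: JD'; exact: JZ.
  exists (s * t); first exact: submonoidM.
  by field; rewrite s0 t0.
- move=> _ _ [a Da [s Ss <-]] [b Jb [t St <-]].
  exists (a * b); first exact: JZ.
  exists (s * t); first exact: submonoidM.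
  by rewrite mulf_div.
Qed.

Lemma localization_scale J x : ext (scale x J) = scale x (ext J).
Proof.
apply/seteqP; split=> [_ [_ [j Jj <-] [s Ss <-]]|_ [_ [j Jj [s Ss <-]] <-]].
  by exists (j / s); [exists j => //; exists s|rewrite mulrA].
by exists (x * j); [exists j|exists s => //; rewrite mulrA].
Qed.

Lemma localization_full P s : ideal D P -> P s -> S s -> ext P = R.
Proof.
move=> iP Ps Ss; apply: ideal_full (localization_ideal iP) _.
by exists s => //; exists s => //; rewrite divff// submonoid_neq0.
Qed.

Lemma localization_prime_mem P a s : prime_ideal D P -> (forall t, S t -> ~ P t) ->
  D a -> S s -> ext P (a / s) -> P a.
Proof.
move=> [[PD [_ _ PZ]] _ PP] PS Da Ss [p Pp [t St e]].
have s0 := submonoid_neq0 Ss; have t0 := submonoid_neq0 St.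
have Ds := submonoid_mem Ss; have Dt := submonoid_mem St.
have aE : a * t = s * p.
  move/eqP: e; rewrite eqr_div// => /eqP e; by rewrite -e mulrC.
have : P (a * t) by rewrite aE; exact: PZ.
by move=> /(PP _ _ Da Dt)[//|/(PS _ St)].
Qed.

Lemma localization_contraction P : prime_ideal D P -> (forall t, S t -> ~ P t) ->
  ext P `&` D = P.
Proof.
move=> pP PS; apply/seteqP; split=> x.
  move=> [Px Dx]; apply: (localization_prime_mem pP PS Dx submonoid1).
  by rewrite divr1.
by move=> Px; split; [exact: sub_localization|case: pP => -[PD _] _ _; exact: PD].
Qed.

Lemma localization_prime P : prime_ideal D P -> (forall t, S t -> ~ P t) ->
  prime_ideal R (ext P).
Proof.
move=> pP PS; have [iP P1 PP] := pP; split; first exact: localization_ideal.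
  move=> eP1; apply: P1; rewrite -(localization_contraction pP PS).
  by split=> //; exact: subring1.
move=> _ _ [a Da [s Ss <-]] [b Db [t St <-]]; rewrite mulf_div => ePab.
have Pab : P (a * b).
  by apply: (localization_prime_mem pP PS _ _ ePab); [exact: subringM|exact: submonoidM].
have [Pa|Pb] := PP _ _ Da Db Pab.
  by left; exists a => //; exists s.
by right; exists b => //; exists t.
Qed.

Lemma localization_colon J : idmul J (colon D J) 1 -> idmul (ext J) (colon R (ext J)) 1.
Proof.
move=> [n [a [b [Ja Jb e]]]]; exists n, a, b; split=> //.
  by move=> i; exact: sub_localization.
move=> i _ [j Jj [s Ss <-]]; exists (b i * j); first exact: Jb.
by exists s => //; rewrite mulrA.
Qed.

Lemma qfield_unitsS A B x : A `<=` B -> (@qfield K A `\ 0) x -> (qfield B `\ 0) x.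
Proof.
move=> AB [[a Aa [b [Ab b0] <-]] x0]; split=> //.
by exists a; [exact: AB|exists b => //; split=> //; exact: AB].
Qed.

(** Provides each class of [R] with a representative extended from [D]: [d I] is an ideal of [R],
    and every ideal of a localization is the extension of its contraction. *)
Lemma fractional_localization I x : fractional_ideal R I -> I x -> x != 0 ->
  exists d J, [/\ (qfield R `\ 0) d, ideal D J, J <> [set 0] & ext J = scale d I].
Proof.
move=> [mI [d [Rd /eqP d0] dI]] Ix x0; have hR := localization_subring.
have [I0 ID IZ] := submodule_scale d mI.
have ext_J : ext (scale d I `&` D) = scale d I.
  apply/seteqP; split=> [_ [a [dIa Da] [s Ss <-]]|y dIy].
    rewrite mulrC; apply: IZ => //; exists 1; first exact: subring1.
    by exists s => //; rewrite mul1r.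
  have [a Da [s Ss e]] : R y by case: dIy => i Ii <-; exact: dI.
  exists a; last by exists s.
  split=> //; have -> : a = s * y by rewrite -e mulrC divfK// submonoid_neq0.
  by apply: IZ => //; apply: sub_localization; exact: submonoid_mem.
exists d, (scale d I `&` D); split=> //.
- by split; [exact: mem_qfield|exact/eqP].
- by apply: ideal_contraction (submodule_scale d mI) => //; exact: sub_localization.
- move=> J0; have : scale d I (d * x) by exists x.
  rewrite -ext_J J0 => -[_ -> [s _]]; rewrite mul0r => /esym/eqP.
  by rewrite mulf_eq0 (negbTE d0) (negbTE x0).
Qed.

End Localization.

(** * Pigeonhole principles for infinite sets *)

Lemma infinite_fiber T U (A : set T) (B : set U) (g : T -> U) :
  infinite_set A -> finite_set B -> (forall x, A x -> B (g x)) ->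
  exists b, infinite_set (A `&` g @^-1` [set b]).
Proof.
move=> Ainf Bfin AB; apply: contrapT => hno; apply: Ainf.
apply: (@sub_finite_set _ _ (\bigcup_(b in B) (A `&` g @^-1` [set b]))).
  by move=> x Ax; exists (g x) => //; exact: AB.
apply: bigcup_finite => // b _; apply: contrapT => fib; by apply: hno; exists b.
Qed.

Lemma infinite_image_in T U (A : set T) (g : T -> U) : infinite_set A ->
  (forall x y, A x -> A y -> g x = g y -> x = y) -> infinite_set (g @` A).
Proof.
move=> Ainf ginj gfin.
have [b bfib] : exists b, infinite_set (A `&` g @^-1` [set b]).
  by apply: infinite_fiber Ainf gfin _ => x Ax; exists x.
have [x [Ax gx]] := infinite_setN0 bfib; apply: bfib.
apply: sub_finite_set (finite_set1 x) => y [Ay gy].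
by apply: ginj => //; rewrite gx gy.
Qed.

(** * Primes of the order over classes of [Pic R] *)

Section OrderClasses.
Variables (K : fieldType) (D S O : set K).
Local Notation R := (localization D S).
Local Notation f := (conductor R O).
Local Notation ext P := (localization P S).
Hypotheses (hD : dedekind D) (hS : submonoid S) (SD : S `<=` D `\ 0).
Hypothesis primeD : forall c, Pic D c -> infinite_set (c `&` height_one D).
Hypothesis hO : order_in R O.
Hypothesis hfin : finite_set (unit_factor_group R O f).

Let dD : subring D. Proof. by case: hD. Qed.
Let hR : subring R. Proof. exact: localization_subring. Qed.
Let rO : subring O. Proof. by case: hO. Qed.
Let OR : O `<=` R. Proof. by case: hO. Qed.

(** [R] is generated over [O] by finitely many [g i], each with a nonzero denominator [b i] in [O];
    the product of the [b i] carries [R] into [O]. *)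
Lemma conductor_neq0 : exists2 x, f x & x != 0.
Proof.
have [_ _ qE [n [g [Rg RE]]]] := hO.
have /choice[b bP] : forall i, exists b, [/\ O b, b != 0 & O (b * g i)].
  move=> i; have : qfield O (g i) by rewrite qE; exact: mem_qfield.
  move=> [a Oa [b [Ob /eqP b0] <-]]; exists b; split=> //.
  by rewrite mulrC divfK.
have Oprod (P : pred 'I_n) : O (\prod_(i | P i) b i).
  elim/big_ind: _ => [|x y|i _]; [exact: subring1|exact: subringM|].
  by have [] := bP i.
exists (\prod_i b i); last by apply/prodf_neq0 => i _; have [] := bP i.
split=> [|r]; first by apply: OR; exact: Oprod.
rewrite {1}RE => -[a [Oa ->]]; rewrite mulr_sumr.
apply: (submodule_sum (submodule_subring rO)) => i.
rewrite (bigD1 i) //=.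
have -> : b i * \prod_(j | j != i) b j * (a i * g i)
  = (\prod_(j | j != i) b j * a i) * (b i * g i) by ring.
by apply: subringM => //; [exact: subringM|have [] := bP i].
Qed.

(** The numerator of a nonzero element of the conductor is again in the conductor. Hence only
    finitely many primes of [D] contain this contraction. *)
Lemma conductor_contraction_neq0 : f `&` D <> [set 0].
Proof.
have [x fx x0] := conductor_neq0 => f0.
have [a Da [s Ss e]] : R x by case: fx.
have s0 := submonoid_neq0 SD Ss.
have : (f `&` D) a.
  split=> //; have -> : a = s * x by rewrite -e mulrC divfK.
  apply: conductorMl => //; apply: sub_localization => //.
  exact: submonoid_mem Ss.
rewrite f0 /= => a0; move: x0; by rewrite -e a0 mul0r eqxx.
Qed.

Lemma ideal_conductor_contraction : ideal D (f `&` D).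
Proof.
have [_ mf] := conductor_ideal hR rO.
by apply: ideal_contraction mf => //; exact: sub_localization.
Qed.

Lemma height_one_neq0 P : height_one D P -> prime_ideal D P /\ P <> [set 0].
Proof.
move=> [pP [Q [[[_ [Q0 _ _]] _ _] [QP nPQ]]] _]; split=> // P0; apply: nPQ.
by rewrite P0 => _ ->.
Qed.

(** [P] is maximal, so for [t] in the contracted conductor but outside [P] there is a relation
    [1 = p + a t], which persists in [R]. *)
Lemma coprime_localization P : prime_ideal D P -> P <> [set 0] ->
  ~ f `&` D `<=` P -> coprime_conductor R O (ext P).
Proof.
move=> pP P0 fP; have [iP _ _] := pP; have [_ _ _ hmax] := hD.
have [_ _ mP] := hmax _ pP P0.
have [t [ft Dt] nPt] : exists2 t, (f `&` D) t & ~ P t.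
  apply: contrapT => hno; apply: fP => t ft; apply: contrapT => nPt.
  by apply: hno; exists t.
have [iJ PJ Jt] := ideal_adjoinP dD iP Dt.
have [JP|JD] := mP _ iJ PJ; first by case: nPt; rewrite -JP.
have : ideal_adjoin D P t 1 by rewrite JD; exact: subring1.
move=> [p [a [Pp Da e]]]; exists p; first exact: sub_localization.
have -> : 1 - p = a * t by rewrite e; ring.
by apply: conductorMl => //; exact: sub_localization.
Qed.

(* Only nontrivial classes of [Pic R] are treated: a prime of [D] meeting [S]
   extends to [R] itself, so it cannot lie over such a class. *)
Lemma primes_in_class C : Pic R C -> C <> ideal_class R R ->
  exists J d I, [/\ C = ideal_class R I, submodule R I, (qfield R `\ 0) d,
    ideal D J & ext J = scale d I] /\
  infinite_set [set P | [/\ exists2 x, (qfield D `\ 0) x & P = scale x J,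
     prime_ideal D P, P <> [set 0], forall s, S s -> ~ P s
   & coprime_conductor R O (ext P)]].
Proof.
move=> /Pic_rep[I invI CE] Ctriv.
have [fI _] := invI; have mI : submodule R I by case: fI.
have [x Ix x0] := invertible_neq0 hR invI.
have [d [J [Rd iJ J0 extJ]]] := fractional_localization dD hS SD fI Ix x0.
exists J, d, I; split; first by [].
have mJ := iJ.2.
have invJ : invertible D J.
  by apply: invertible_colon => //; exact: dedekind_colon.
have finP := dedekind_finite_primes hD ideal_conductor_contraction
  conductor_contraction_neq0.
(* The class of [J] in [Pic D], less the finitely many primes containing the contracted conductor,
   supplies the primes. *)
apply: sub_infinite_set (infinite_setD (primeD (Pic_ideal_class invJ)) finP).
move=> P [[/(ideal_classP _ dD mJ)[y Dy PE] /height_one_neq0[pP P0]] nfP].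
split=> //; first by exists y.
- move=> s Ss Ps; apply: Ctriv; have [iP _ _] := pP.
  have Ryd : (qfield R `\ 0) (y * d).
    apply: qfield_unitsM => //; apply: qfield_unitsS Dy; exact: sub_localization.
  rewrite CE -(ideal_class_scale hR mI Ryd) -scaleA -extJ -localization_scale -PE.
  by rewrite (localization_full hS SD iP Ps Ss).
- apply: coprime_localization => // fP; exact: nfP.
Qed.

(* [y] lies over the fixed prime [P0] like [t], with [t = 1] modulo the conductor:
   [y] generates [Q Q0^-1 t]. *)
Lemma relative_generator J P0 P t :
  let Q0 := ext P0 in let Q := ext P in
  (exists2 x, (qfield D `\ 0) x & P0 = scale x J) ->
  (exists2 x, (qfield D `\ 0) x & P = scale x J) ->
  ideal D P0 -> ideal D P -> P <> [set 0] ->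
  Q0 t -> t != 0 -> f (1 - t) -> coprime_conductor R O Q ->
  exists y, [/\ R y, y != 0,
    exists z, [/\ R z, z != 0 & f (y * z - 1)] & Q = scale (y / t) Q0].
Proof.
move=> Q0 Q [x0 [_ /eqP x00] P0E] [x [_ /eqP x_0] PE] iP0 iP Pn0 Q0t t0 ft cQ.
have iQ : ideal R Q by exact: localization_ideal.
have iQ0 : ideal R Q0 by exact: localization_ideal.
have QE : Q = scale (x / x0) Q0.
  by rewrite /Q /Q0 PE P0E !localization_scale scaleA divfK.
have [p Pp p0] := submodule_neq0 iP.2 Pn0.
have [s [Qs s0 fs]] :=
  coprime_conductor_neq0 hR rO iQ (sub_localization hS Pp) p0 cQ.
have xx0 : x / x0 != 0 by rewrite mulf_neq0 ?invr_eq0.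
(* With [s = (x / x0) z] and [y = (x / x0) t] one gets [y z = s t], which is [1] modulo the
   conductor. *)
move: (Qs); rewrite QE => -[z Q0z sE].
have Rt : R t by exact: iQ0.1.
have Rs : R s by exact: iQ.1.
exists (x / x0 * t); split.
- by apply: iQ.1; rewrite QE; exists t.
- exact: mulf_neq0.
- exists z; split; first exact: iQ0.1.
    by apply/eqP => z0; move: s0; rewrite -sE z0 mulr0 eqxx.
  have -> : x / x0 * t * z - 1 = - ((1 - t) * s + (1 - s)) by rewrite -sE; ring.
  apply: conductorN => //; apply: conductorD => //.
  exact: conductorMr.
- by rewrite mulfK.
Qed.

(** Each prime of [W] yields a unit modulo the conductor; by finiteness of the factor group
    infinitely many of these share a class, and their primes then contract into a single class of
    [Pic O]. The ideal [Q] in the conclusion serves to recover [C] from [kappa]. *)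
Lemma infinite_class_over C : Pic R C -> C <> ideal_class R R ->
  exists kappa, [/\ Pic O kappa,
    infinite_set [set P | [/\ kappa P, invertible O P & prime_ideal O P]]
  & exists Q, [/\ ideal R Q, coprime_conductor R O Q, C = ideal_class R Q
              & kappa = ideal_class O (Q `&` O)]].
Proof.
move=> PC Ctriv.
have [J [d [I [[CE mI Rd iJ extJ] Winf]]]] := primes_in_class PC Ctriv.
set W := (X in infinite_set X) in Winf.
have WP P : W P -> [/\ ideal R (ext P), coprime_conductor R O (ext P),
    C = ideal_class R (ext P), invertible O (ext P `&` O)
  & prime_ideal O (ext P `&` O)].
  move=> [[x Dx PE] pP P0 PS cP]; have [iP _ _] := pP.
  have iQ : ideal R (ext P) by exact: localization_ideal.
  split=> //.
  - rewrite CE PE localization_scale extJ scaleA ideal_class_scale//.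
    by apply: qfield_unitsM => //; apply: qfield_unitsS Dx; exact: sub_localization.
  - have [p Pp p0] := submodule_neq0 iP.2 P0.
    apply: (invertible_contraction hR rO OR iQ (sub_localization hS Pp) p0) => //.
      exact: conductor_neq0.
    by apply: localization_colon => //; exact: dedekind_colon.
  - by apply: (prime_contraction rO OR); exact: localization_prime.
have [P0 W0] := infinite_setN0 Winf.
have [gP0 pP0 P00 _ _] := W0; have [iP0 _ _] := pP0.
have [iQ0 cQ0 _ _ _] := WP _ W0.
have [p Pp p0] := submodule_neq0 iP0.2 P00.
have [t [Q0t t0 ft]] :=
  coprime_conductor_neq0 hR rO iQ0 (sub_localization hS Pp) p0 cQ0.
have : forall P, exists y, W P -> [/\ R y, y != 0,
    exists z, [/\ R z, z != 0 & f (y * z - 1)] & ext P = scale (y / t) (ext P0)].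
  move=> P; have [WP'|nW] := EM (W P); last by exists 0.
  have [gP [iP _ _] Pn0 _ cP] := WP'.
  by have [y yP] := relative_generator gP0 gP iP0 iP Pn0 Q0t t0 ft cP; exists y.
move=> /choice[y yP].
have [e einf] : exists e, infinite_set (W `&` (unit_factor_class R O \o y) @^-1` [set e]).
  apply: infinite_fiber Winf hfin _ => P /yP[Ry _ [z [Rz _ fyz]] _].
  exact: mem_unit_factor_group fyz.
have [P1 [W1 e1]] := infinite_setN0 einf.
have [iQ1 cQ1 CE1 invQ1 _] := WP _ W1.
exists (ideal_class O (ext P1 `&` O)); split.
- exact: Pic_ideal_class.
(* [P] can be recovered from its image: by coprimality the contraction to [O] determines [ext P],
   and [P] is the contraction of [ext P] to [D]. *)
- have inj : infinite_set ((fun P => ext P `&` O) @`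
      (W `&` (unit_factor_class R O \o y) @^-1` [set e])).
    apply: infinite_image_in einf _ => P P' [WP1 _] [WP2 _] eqO.
    have [iQ cQ _ _ _] := WP _ WP1; have [iQ' cQ' _ _ _] := WP _ WP2.
    have [_ pP _ PS _] := WP1; have [_ pP' _ PS' _] := WP2.
    rewrite -(localization_contraction hS SD pP PS).
    rewrite -(localization_contraction hS SD pP' PS').
    congr (_ `&` _).
    have := @eq_of_contraction _ _ _ hR rO 1 _ _ (oner_neq0 K) iQ iQ' cQ cQ'.
    by rewrite !scale1; apply.
  apply: sub_infinite_set inj => _ [P [WP1 eP] <-].
  have [iQ cQ CEP invQ pQ] := WP _ WP1; split=> //.
  have [Ry y0 [z [Rz z0 fyz]] QE] := yP _ WP1.
  have [Ry1 y10 _ Q1E] := yP _ W1.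
  rewrite -(contraction_class_eq hR rO OR Ry Ry1 Rz y0 y10 z0 fyz iQ iQ1).
  + by apply: mem_ideal_class => //; case: invQ => -[].
  (* Both sides are [ext P0] scaled by [y P * y P1 / t]. *)
  + by rewrite QE Q1E !scaleA mulrCA.
  + by rewrite [LHS]eP [RHS]e1.
- by exists (ext P1).
Qed.

(** [kappa] is injective on the nontrivial classes: a scalar relating the contractions of [Q] and
    [Q'] also relates [Q] and [Q']. Removing the trivial class keeps [Pic R] infinite. *)
Lemma infinite_order_classes : infinite_set (Pic R) ->
  infinite_set [set c | Pic O c /\
    infinite_set [set P | [/\ c P, invertible O P & prime_ideal O P]]].
Proof.
move=> PRinf; have := infinite_setD PRinf (finite_set1 (ideal_class R R)).
set B := _ `\` _ => Binf.
have /choice[kappa kP] : forall C, exists kappa, B C -> [/\ Pic O kappa,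
    infinite_set [set P | [/\ kappa P, invertible O P & prime_ideal O P]]
  & exists Q, [/\ ideal R Q, coprime_conductor R O Q, C = ideal_class R Q
              & kappa = ideal_class O (Q `&` O)]].
  move=> C; have [BC|nBC] := EM (B C); last by exists set0.
  by have [k kP] := infinite_class_over BC.1 BC.2; exists k.
apply: (@sub_infinite_set _ (kappa @` B)) => [_ [C BC <-]|].
  by have [] := kP _ BC.
apply: infinite_image_in Binf _ => C C' BC BC' ek.
have [_ _ [Q [iQ cQ CE kE]]] := kP _ BC.
have [_ _ [Q' [iQ' cQ' CE' kE']]] := kP _ BC'.
have mQO M : ideal R M -> submodule O (M `&` O).
  by case=> _ mM; exact: (ideal_contraction _ OR mM).2.
have : ideal_class O (Q' `&` O) (Q `&` O).
  by rewrite -kE' -ek kE; apply: mem_ideal_class => //; exact: mQO.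
move=> /(ideal_classP _ rO (mQO _ iQ'))[x Ox xE].
have /eqP x0 := Ox.2.
rewrite CE CE' (eq_of_contraction hR rO x0 iQ iQ' cQ cQ' xE).
(* The scalar comes from the quotient field of [O], which is that of [R]. *)
rewrite ideal_class_scale //; first exact: iQ'.2.
by case: hO => _ _ <- _.
Qed.

End OrderClasses.

(** * Reduction of both cases for [R] to a localization *)

Lemma localization1 (K : fieldType) (D : set K) : localization D [set 1] = D.
Proof.
apply/seteqP; split=> [_ [a Da [_ -> <-]]|x Dx]; first by rewrite divr1.
by exists x => //; exists 1 => //; rewrite divr1.
Qed.

Theorem corollary9 (G : nat -> zmodType) (K : fieldType) (D : set K)
    (S : nat -> set K) (R O : set K)
    (hG : forall i, fg_group (G i))
    (hD : dedekind D)
    (hPicD : isomorphic (Pic D) (@Pic_mul K) (@dsum G) (@dsum_add G))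
    (hS : forall i, submonoid (S i) /\ S i `<=` D `\ 0)
    (hPicS : forall i, isomorphic (Pic (localization D (S i))) (@Pic_mul K)
                         [set: G i] +%R)
    (hprimeD : forall c, Pic D c -> infinite_set (c `&` height_one D))
    (hprimeS : forall i c, Pic (localization D (S i)) c ->
                 infinite_set (c `&` height_one (localization D (S i))))
    (hR : R = D \/ exists S0 : set K,
            [/\ submonoid S0, S0 `<=` D `\ 0 & R = localization D S0])
    (hPicR : infinite_set (Pic R))
    (hO : order_in R O)
    (hfin : finite_set (unit_factor_group R O (conductor R O))) :
  infinite_set [set c | Pic O c /\
    infinite_set [set P | [/\ c P, invertible O P & prime_ideal O P]]].
Proof.
have [S0 [mS0 S0D RE]] : exists S0 : set K,
    [/\ submonoid S0, S0 `<=` D `\ 0 & R = localization D S0].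
  (* The case [R = D] is the localization at the submonoid containing only [1]. *)
  case: hR => [->|//]; exists [set 1]; split; last by rewrite localization1.
    by split=> [|x y]; rewrite !inE //= => -> ->; rewrite mulr1.
  move=> _ ->; split; last exact/eqP/oner_neq0.
  by case: hD => /subring1.
rewrite RE in hPicR hO hfin.
exact: (infinite_order_classes hD mS0 S0D hprimeD hO hfin hPicR).
Qed.
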